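(* Suppose that $x_a<x_b$ $\mu$-a.e. and that there is no Slater point, i.e. there is no $\hat x\in L^p(\mu)$ with $x_a<\hat x<x_b$ $\mu$-a.e. on $\Omega$, $\langle g_i,\hat x\rangle\le a_i$ for all $i=1,\dots,n$ and $\langle h_j,\hat x\rangle=b_j$ for all $j=1,\dots,m$. Further assume that $p>1$ (i.e. $p'<\infty$) and that the measure $\mu$ is nonatomic. Then, for each feasible point $\bar x\in K\cap P$, there exists a linear functional $F\in L^{p'}(\mu)$ such that $\bar x$ minimizes $x\mapsto\langle F,x\rangle$ on $K\cap P$, but no Lagrange multiplier exists; that is, there are no $\zeta\in L^{p'}(\mu)$, $\alpha_i\ge0$ ($i\in\mathcal A(\bar x)$), $\beta_j\in\mathbb R$ ($j=1,\dots,m$) with $$F+\zeta+\sum_{i\in\mathcal A(\bar x)}\alpha_i g_i+\sum_{j=1}^m\beta_j h_j=0$$ and $\zeta\le0$ $\mu$-a.e. on $\{x_a=\bar x<x_b\}$, $\zeta=0$ $\mu$-a.e. on $\{x_a<\bar x<x_b\}$, $\zeta\ge0$ $\mu$-a.e. on $\{x_a<\bar x=x_b\}$, where $\mathcal A(\bar x)=\{i\in\{1,\dots,n\}:\langle g_i,\bar x\rangle=a_i\}$.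
   Context: Let $(\Omega,\Sigma,\mu)$ be a $\sigma$-finite measure space, $p\in[1,\infty]$ and $p'\in[1,\infty]$ the conjugate exponent, $1/p+1/p'=1$ (with $1/\infty=0$). All function spaces are real, and $\langle y,x\rangle=\int_\Omega yx\,d\mu$ for $y\in L^{p'}(\mu)$, $x\in L^p(\mu)$. Let $x_a,x_b:\Omega\to[-\infty,\infty]$ be measurable, let $n,m$ be nonnegative integers, and let $g_1,\dots,g_n,h_1,\dots,h_m\in L^{p'}(\mu)$, $a_i,b_j\in\mathbb R$. Put $$K=\{x\in L^p(\mu): x_a\le x\le x_b\ \mu\text{-a.e.}\},\qquad P=\{x\in L^p(\mu): \langle g_i,x\rangle\le a_i\ (1\le i\le n),\ \langle h_j,x\rangle=b_j\ (1\le j\le m)\}.$$ Notation such as $\{x_a=\bar x<x_b\}$ denotes $\{\omega\in\Omega: x_a(\omega)=\bar x(\omega)<x_b(\omega)\}$. *)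

(* Defs.v *)
From HB Require Import structures.
From mathcomp Require Import all_boot all_order all_algebra.
From mathcomp Require Import all_classical all_reals all_analysis.
From mathcomp Require Import measurable_realfun.

Set Implicit Arguments.
Unset Strict Implicit.
Unset Printing Implicit Defensive.
Import Order.TTheory GRing.Theory Num.Theory.
Import numFieldNormedType.Exports.

Local Open Scope classical_set_scope.
Local Open Scope ring_scope.

(* Elements of L^p(mu) are handled through representatives, i.e. functions
   T -> R in Lfun mu p; every condition imposed on them is invariant under mu-a.e.
   equality. *)
Section LpProblem.
Context {d : measure_display} {T : measurableType d} {R : realType}.
Variable mu : {measure set T -> \bar R}.

Definition is_atom (A : set T) : Prop :=
  [/\ measurable A, (0 < mu A)%E &
      forall B, measurable B -> B `<=` A -> (mu B < mu A)%E -> mu B = 0%E].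

Definition nonatomic : Prop := forall A, ~ is_atom A.

(* Rintegral returns a junk value on a nonintegrable function; by Hoelder's
   inequality this does not occur for y, x in conjugate Lebesgue spaces. *)
Definition lp_pairing (y x : T -> R) : R := \int[mu]_w (y w * x w).

Variables (p : \bar R) (xa xb : T -> \bar R).

Definition box_feasible : set (T -> R) :=
  [set x | x \in Lfun mu p /\
           {ae mu, forall w, (xa w <= (x w)%:E <= xb w)%E}].

Variables (n m : nat) (g : 'I_n -> T -> R) (h : 'I_m -> T -> R).
Variables (a : 'I_n -> R) (b : 'I_m -> R).

Definition linear_feasible : set (T -> R) :=
  [set x | [/\ x \in Lfun mu p, forall i, lp_pairing (g i) x <= a i &
               forall j, lp_pairing (h j) x = b j]].

Definition slater_point (x : T -> R) : Prop :=
  [/\ x \in Lfun mu p,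
      {ae mu, forall w, (xa w < (x w)%:E < xb w)%E},
      forall i, lp_pairing (g i) x <= a i &
      forall j, lp_pairing (h j) x = b j].

Definition active (x : T -> R) : pred 'I_n :=
  [pred i | lp_pairing (g i) x == a i].

(* The values of alpha at inactive indices are unconstrained and unused. *)
Definition lagrange_multiplier (q : \bar R) (F x : T -> R)
    (zeta : T -> R) (alpha : 'I_n -> R) (beta : 'I_m -> R) : Prop :=
  [/\ zeta \in Lfun mu q,
      forall i, active x i -> 0 <= alpha i,
      {ae mu, forall w,
         F w + zeta w + \sum_(i < n | active x i) alpha i * g i w
         + \sum_(j < m) beta j * h j w = 0} &
      [/\ {ae mu, forall w, (xa w = (x w)%:E)%E -> ((x w)%:E < xb w)%E ->
                            zeta w <= 0},
          {ae mu, forall w, (xa w < (x w)%:E < xb w)%E -> zeta w = 0} &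
          {ae mu, forall w, (xa w < (x w)%:E)%E -> ((x w)%:E = xb w)%E ->
                            0 <= zeta w}]].

End LpProblem.

(* Main.v *)
Require Import Defs.
From HB Require Import structures.
From mathcomp Require Import all_boot all_order all_algebra.
From mathcomp Require Import all_classical all_reals all_analysis.
From mathcomp Require Import measurable_realfun ess_sup_inf ring lra.

Set Implicit Arguments.
Unset Strict Implicit.
Unset Printing Implicit Defensive.
Import Order.TTheory GRing.Theory Num.Theory.
Import numFieldNormedType.Exports.

Local Open Scope classical_set_scope.
Local Open Scope ring_scope.

(** Without a Slater point the constraints leave no freedom on a set of positive
measure, and there the optimality condition can be violated at will.

Let S be the set of x in L^p with xa < x < xb almost everywhere. It is convex,
and it is nonempty because xbar can be pushed off both bounds. Writing each
equation as two inequalities, the absence of a Slater point says that finitely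
many affine inequalities have no solution in S. By the theorem of the alternative
([alternative]), a nonnegative combination of them, x |-> <G, x> - gamma with G in
the span of the g_i and h_j, is positive on all of S. The classical separation
theorem would only give nonnegative and nonzero coefficients; the stronger
conclusion, which makes G nonzero, is available because S has no proper supporting
hyperplane of the form <G, .> = gamma ([unsupported]): at a point strictly between
the bounds, a functional that is minimal over the box must have G = 0.

The combination is nonnegative on the whole box K by passing to the limit along
segments, and nonpositive at every feasible point. So every feasible x minimizes
<G, .> over K, hence x = xa where G > 0 and x = xb where G < 0
([box_minimizer_complementarity]). All feasible points therefore coincide on
D = {G <> 0}, which has positive measure ([no_interior_point_rigidity]).

Consequently any F supported in D has a constant pairing with feasible points, and
xbar is trivially a minimizer. Take F = - sgn(G) phi with phi >= 0 in L^q. Since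
the sign condition on zeta is sgn(G) zeta <= 0 on D, the multiplier equation would
give phi <= C (sum_i |g_i| + sum_j |h_j|) on D for some constant C. As mu is
nonatomic and q is finite, phi can be chosen to violate every such bound
([Lfun_not_dominated]): it is unbounded on a subset of D where the right-hand sum is
bounded. *)

(** * A theorem of the alternative for affine inequalities *)

Section theorem_of_the_alternative.
Context {R : realType} {V : lmodType R}.
Implicit Types (S : set V) (f k M : V -> R).

Definition convex_subset S := forall (x y : V) (t : R),
  S x -> S y -> 0 <= t <= 1 -> S (t *: x + (1 - t) *: y).

Definition affine_on S f := forall (x y : V) (t : R),
  S x -> S y -> 0 <= t <= 1 ->
  f (t *: x + (1 - t) *: y) = t * f x + (1 - t) * f y.

Definition comb {I : Type} (s : seq I) (c : I -> R) (f : I -> V -> R) : V -> R :=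
  fun x => \sum_(i <- s) c i * f i x.

(** Every functional in the span of [f] that is nonnegative on [S] and vanishes
somewhere on [S] vanishes on all of [S]. For a convex set in finite dimension this is
relative openness; this form needs no topology, and it can be verified in L^p, where
the set of functions strictly between two bounds has empty interior in general. *)
Definition unsupported {I : Type} S (s : seq I) (f : I -> V -> R) :=
  forall c : I -> R, (forall x, S x -> 0 <= comb s c f x) ->
  forall x, S x -> comb s c f x = 0 -> forall y, S y -> comb s c f y = 0.

Lemma affine_on_sub S S' f : S' `<=` S -> affine_on S f -> affine_on S' f.
Proof. by move=> SS' fS x y t /SS' Sx /SS' Sy; exact: fS. Qed.

Lemma affine_on_comb (I : eqType) S (s : seq I) c (f : I -> V -> R) :
  (forall i, i \in s -> affine_on S (f i)) -> affine_on S (comb s c f).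
Proof.
move=> fS x y t Sx Sy t01; rewrite /comb !mulr_sumr -big_split/=.
by apply: eq_big_seq => i si; rewrite fS//; ring.
Qed.

(** The points (k x, M x) form a convex set in the plane that meets both open
half-planes k < 0 and 0 < k and crosses the axis k = 0 only at heights M >= 0. The
line through the origin with slope - nu lies below it, where nu is the infimum of
M y / - k y over k y < 0: comparing with a point of the other side, the convexity
bound reads - M x / k x <= M y / - k y. *)
Lemma separation_on_zero_set S k M : convex_subset S ->
  affine_on S k -> affine_on S M ->
  (exists2 x, S x & k x < 0) -> (exists2 x, S x & 0 < k x) ->
  (forall x, S x -> k x = 0 -> 0 <= M x) ->
  exists nu, forall x, S x -> 0 <= M x + nu * k x.
Proof.
move=> cS kS MS [y0 Sy0 ky0] [x0 Sx0 kx0] M0.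
pose A := [set M y / - k y | y in [set y | S y /\ k y < 0]].
have lbA x : S x -> 0 < k x -> lbound A (- M x / k x).
  move=> Sx kx _ [y [Sy ky] <-].
  have kxy : 0 < k x - k y by lra.
  (* the weight for which the combination lies on the zero set of k *)
  pose t := k x / (k x - k y).
  have t01 : 0 <= t <= 1.
    rewrite /t divr_ge0 ?(ltW kx) ?(ltW kxy)//= ler_pdivrMr// mul1r; lra.
  have := M0 _ (cS y x t Sy Sx t01).
  rewrite kS// MS//.
  have -> : t * k y + (1 - t) * k x = 0 by rewrite /t; field; lra.
  move=> /(_ erefl).
  have -> : t * M y + (1 - t) * M x = (k x * M y - k y * M x) / (k x - k y).
    by rewrite /t; field; lra.
  rewrite pmulr_lge0 ?invr_gt0// => H.
  by rewrite ler_pdivrMr// mulrAC ler_pdivlMr ?oppr_gt0//; lra.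
exists (inf A) => x Sx.
have hlA : has_lbound A by exists (- M x0 / k x0); exact: lbA.
have [kx|kx|kx0'] := ltgtP (k x) 0.
- have : inf A <= M x / - k x by apply: ge_inf => //; exists x.
  by rewrite ler_pdivlMr ?oppr_gt0//; lra.
- have : - M x / k x <= inf A.
    by apply: lb_le_inf; [exists (M y0 / - k y0), y0|exact: lbA].
  by rewrite ler_pdivrMr//; lra.
- by rewrite kx0' mulr0 addr0 M0.
Qed.

Lemma segment_limit_ge0 (a b : R) :
  (forall t, 0 < t -> t <= 1 -> 0 < t * b + (1 - t) * a) -> 0 <= a.
Proof.
move=> H; rewrite leNgt; apply/negP => a0.
have b0 : 0 < b by have := H 1 ltr01 (lexx _); rewrite mul1r subrr mul0r addr0.
have D : 0 < b - a by lra.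
have t0 : 0 < - a / (b - a) by rewrite divr_gt0// oppr_gt0.
have t1 : - a / (b - a) <= 1 by rewrite ler_pdivrMr// mul1r; lra.
have := H _ t0 t1.
have -> : - a / (b - a) * b + (1 - - a / (b - a)) * a = 0 by field; lra.
by rewrite ltxx.
Qed.

Lemma comb_cons (I : eqType) (j : I) s nu c (f : I -> V -> R) x : j \notin s ->
  comb (j :: s) (fun i => if i == j then nu else c i) f x =
  comb s c f x + nu * f j x.
Proof.
move=> js; rewrite /comb big_cons eqxx addrC; congr (_ + _).
apply: eq_big_seq => i si; case: eqP => // ij.
by move: js; rewrite -ij si.
Qed.

(** A functional that is nonnegative where [f j] < 0 and vanishes at such a point
[x] is nonnegative on all of [S]: the segment from [x] to any [z] in [S] starts inside
[f j] < 0, and an affine function vanishing at [x] keeps its sign along it. So the hypothesis on [S] applies. *)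
Lemma unsupported_negative_part (I : eqType) S j (s : seq I) (f : I -> V -> R) :
  convex_subset S -> (forall i, i \in j :: s -> affine_on S (f i)) ->
  j \notin s -> unsupported S (j :: s) f ->
  unsupported (S `&` [set x | f j x < 0]) s f.
Proof.
move=> cS fS js unS c cge0 x [Sx /= fjx] cx0 y [Sy _].
have aS : affine_on S (comb s c f).
  by apply: affine_on_comb => i si; apply: fS; rewrite inE si orbT.
have cE z : comb (j :: s) (fun i => if i == j then 0 else c i) f z = comb s c f z.
  by rewrite comb_cons// mul0r addr0.
rewrite -cE; apply: (unS _ _ x) => //; rewrite ?cE// => z Sz; rewrite cE.
(* any step strictly shorter than t from x towards z keeps f j negative *)
pose t := - f j x / (`|f j z| - f j x).
have D : 0 < `|f j z| - f j x by have := normr_ge0 (f j z); lra.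
have t0 : 0 < t by rewrite divr_gt0// oppr_gt0.
have t1 : t <= 1 by rewrite ler_pdivrMr// mul1r; have := normr_ge0 (f j z); lra.
have h01 : 0 <= t / 2 <= 1 by lra.
have := cge0 (t / 2 *: z + (1 - t / 2) *: x) _.
rewrite aS// cx0 mulr0 addr0 pmulr_rge0; last lra.
apply; split; first exact: cS.
rewrite /= (fS j)//; last by rewrite inE eqxx.
have tf : t * f j z <= (1 - t) * - f j x.
  apply: (@le_trans _ _ (t * `|f j z|)); first by rewrite ler_wpM2l ?ler_norm// ltW.
  by rewrite /t le_eqVlt; apply/orP; left; apply/eqP; field; lra.
nra.
Qed.

(** By [separation_on_zero_set], a functional that is nonnegative on the slice
[f j] = 0 becomes nonnegative on [S] once a multiple of [f j] is added, which does not
change it on the slice. *)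
Lemma unsupported_zero_part (I : eqType) S j (s : seq I) (f : I -> V -> R) :
  convex_subset S -> (forall i, i \in j :: s -> affine_on S (f i)) ->
  j \notin s -> unsupported S (j :: s) f ->
  (exists2 x, S x & f j x < 0) -> (exists2 x, S x & 0 < f j x) ->
  unsupported (S `&` [set x | f j x = 0]) s f.
Proof.
move=> cS fS js unS neg pos c cge0 x [Sx /= fjx] cx0 y [Sy fjy].
have [|nu nuge0] := separation_on_zero_set cS (fS j (mem_head _ _))
   (affine_on_comb (s := s) c _) neg pos (fun z Sz fz => cge0 z (conj Sz fz)).
  by move=> i si; apply: fS; rewrite inE si orbT.
have : comb (j :: s) (fun i => if i == j then nu else c i) f y = 0.
  apply: (unS _ _ x) => //; last by rewrite comb_cons// cx0 fjx mulr0 addr0.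
  by move=> z Sz; rewrite comb_cons//; exact: nuge0.
by rewrite comb_cons// fjy mulr0 addr0.
Qed.

Lemma convex_subset_sign S k (P : R -> Prop) : convex_subset S -> affine_on S k ->
  (forall a b t, P a -> P b -> 0 <= t <= 1 -> P (t * a + (1 - t) * b)) ->
  convex_subset (S `&` [set x | P (k x)]).
Proof.
move=> cS kS cP x y t [Sx Px] [Sy Py] t01; split; first exact: cS.
by rewrite /= kS//; exact: cP.
Qed.

(** Induction on the list of constraints. Let [f j] be the first one, taking both
signs on [S] (the other cases drop it or use it alone). A solution cannot exist in
S' = {f j < 0}, so the induction hypothesis gives a combination M of the others that
is positive on S', and planar separation gives mu >= 0 with M + mu * f j >= 0 on [S].
If this is identically zero, solutions on the slice {f j = 0} remain to be used: the
induction hypothesis there gives M' > 0 on the slice and M' + nu * f j >= 0 on [S], with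
nu of any sign; adding a multiple of the null combination M + mu * f j makes the
coefficient of [f j] nonnegative and leaves the functional unchanged. *)
Theorem alternative (I : eqType) (s : seq I) S (f : I -> V -> R) : uniq s ->
  convex_subset S -> (exists x, S x) ->
  (forall i, i \in s -> affine_on S (f i)) -> unsupported S s f ->
  ~ (exists2 x, S x & forall i, i \in s -> f i x <= 0) ->
  exists2 c : I -> R, forall i, 0 <= c i & forall x, S x -> 0 < comb s c f x.
Proof.
elim: s S => [|j s IH] S.
  by move=> _ _ [x Sx] _ _ []; exists x.
move=> /= /andP[js us] cS [w Sw] fS unS nosol.
have fjS : affine_on S (f j) by apply: fS; exact: mem_head.
have fsS i : i \in s -> affine_on S (f i).
  by move=> si; apply: fS; rewrite inE si orbT.
(* S being unsupported, a single zero would make the combination vanish *)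
have pos c : (forall x, S x -> 0 <= comb (j :: s) c f x) ->
    (exists2 x, S x & comb (j :: s) c f x != 0) ->
    forall x, S x -> 0 < comb (j :: s) c f x.
  move=> cge0 [x Sx cx] y Sy; rewrite lt_neqAle cge0// andbT eq_sym.
  by apply: contra_neq cx => cy; exact: (unS c cge0 y).
have upd_ge0 nu c i : 0 <= nu -> (forall i, 0 <= c i) ->
    0 <= (if i == j then nu else c i : R) by move=> ? ?; case: ifP.
have [negj|] := pselect (exists2 x, S x & f j x < 0); last first.
  move=> /forall2NP nneg.
  have fj_ge0 x : S x -> 0 <= f j x.
    by move=> Sx; have [//|/negP] := nneg x; rewrite -leNgt.
  have c1E x : comb (j :: s) (fun i => if i == j then 1 else 0) f x = f j x.
    by rewrite comb_cons// mul1r /comb big1 ?add0r// => i _; rewrite mul0r.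
  have [fj0|fjN0] := pselect (exists2 x, S x & f j x = 0); last first.
    exists (fun i => if i == j then 1 else 0) => [i|x Sx]; first by case: ifP.
    rewrite c1E lt_neqAle fj_ge0// andbT eq_sym; apply/eqP => fjx.
    by apply: fjN0; exists x.
  (* f j is nonnegative with a zero, hence null, and can be dropped *)
  have {fj0} fj0 x : S x -> f j x = 0.
    move=> Sx; case: fj0 => z Sz fz.
    by rewrite -c1E; apply: (unS _ _ z) => // [u Su|]; rewrite c1E// fj_ge0.
  have [| |c c0 cpos] := IH S us cS (ex_intro _ w Sw) fsS.
  - move=> c cge0 x Sx cx0 y Sy.
    have cE z : comb (j :: s) (fun i => if i == j then 0 else c i) f z = comb s c f z.
      by rewrite comb_cons// mul0r addr0.
    by rewrite -cE; apply: (unS _ _ x) => // [u Su|]; rewrite cE// cge0.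
  - move=> [x Sx fx]; apply: nosol; exists x => // i; rewrite inE => /predU1P[->|/fx//].
    by rewrite fj0.
  exists (fun i => if i == j then 0 else c i) => [i|x Sx]; first exact: upd_ge0.
  by rewrite comb_cons// mul0r addr0 cpos.
pose Sneg := S `&` [set x | f j x < 0].
have [| | | | |c c0 cpos] := IH Sneg us.
- apply: (@convex_subset_sign _ _ (fun r => r < 0)) => // a b t a0 b0 t01; nra.
- by case: negj => x Sx fx; exists x.
- by move=> i si; apply: (affine_on_sub _ (fsS i si)) => x [].
- exact: unsupported_negative_part.
- move=> [x [Sx /= fjx] fx]; apply: nosol; exists x => // i.
  by rewrite inE => /predU1P[->|/fx//]; exact: ltW.
have Sneg_ge0 x : S x -> f j x <= 0 -> 0 <= comb s c f x.
  move=> Sx; rewrite le_eqVlt => /predU1P[fx|fx]; last exact/ltW/cpos.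
  case: negj => y Sy fy; apply: (@segment_limit_ge0 _ (comb s c f y)) => t t0 t1.
  have t01 : 0 <= t <= 1 by rewrite t1 ltW.
  rewrite -(affine_on_comb (S := S))//; apply: cpos; split; first exact: cS.
  by rewrite /= fjS// fx mulr0 addr0 pmulr_rlt0.
have [posj|/forall2NP npos] := pselect (exists2 x, S x & 0 < f j x); last first.
  exists (fun i => if i == j then 0 else c i) => [i|]; first exact: upd_ge0.
  apply: pos => [x Sx|]; last first.
    case: negj => x Sx fx; exists x => //.
    by rewrite comb_cons// mul0r addr0 gt_eqF// cpos.
  rewrite comb_cons// mul0r addr0 Sneg_ge0//.
  by have [//|/negP] := npos x; rewrite -leNgt.
have [mu mu0 combmu] : exists2 mu, 0 <= mu &
    forall x, S x -> 0 <= comb s c f x + mu * f j x.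
  have [|nu nuge0] := separation_on_zero_set cS fjS
     (affine_on_comb c fsS) negj posj.
    by move=> x Sx fx; rewrite Sneg_ge0// fx.
  have [nu0|nu0] := leP 0 nu; first by exists nu.
  exists 0 => // x Sx; rewrite mul0r addr0.
  have [fx|fx] := leP (f j x) 0; first exact: Sneg_ge0.
  by have := nuge0 x Sx; nra.
(* only a combination that is identically zero fails to conclude here *)
have [[x Sx Mx]|/forall2NP M0] :=
    pselect (exists2 x, S x & comb s c f x + mu * f j x != 0).
  exists (fun i => if i == j then mu else c i) => [i|]; first exact: upd_ge0.
  apply: pos => [y Sy|]; first by rewrite comb_cons// combmu.
  by exists x => //; rewrite comb_cons.
have {}M0 x : S x -> comb s c f x + mu * f j x = 0.
  by move=> Sx; have [//|/negP/negPn/eqP] := M0 x.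
have mu_gt0 : 0 < mu.
  rewrite lt_neqAle mu0 andbT eq_sym; apply/eqP => mu_eq0.
  case: negj => x Sx fx; have := M0 x Sx; rewrite mu_eq0 mul0r addr0 => cx.
  by have := cpos x (conj Sx fx); rewrite cx ltxx.
pose Szero := S `&` [set x | f j x = 0].
have [z Sz] : exists z, Szero z.
  case: negj posj => [x Sx fx] [y Sy fy].
  have D : 0 < f j y - f j x by lra.
  pose t := f j y / (f j y - f j x).
  have t01 : 0 <= t <= 1.
    by rewrite /t divr_ge0 ?(ltW fy) ?(ltW D)//= ler_pdivrMr// mul1r; lra.
  exists (t *: x + (1 - t) *: y); split; first exact: cS.
  by rewrite /= fjS// /t; field; lra.
have [| | | | |c' c'0 c'pos] := IH Szero us.
- apply: (@convex_subset_sign _ _ (fun r => r = 0)) => // a b t -> -> _; ring.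
- by exists z.
- by move=> i si; apply: (affine_on_sub _ (fsS i si)) => x [].
- exact: unsupported_zero_part.
- move=> [x [Sx /= fjx] fx]; apply: nosol; exists x => // i.
  by rewrite inE => /predU1P[->|/fx//]; rewrite fjx.
have [|nu nuge0] := separation_on_zero_set cS fjS
   (affine_on_comb c' fsS) negj posj.
  by move=> x Sx fx; exact/ltW/c'pos.
pose k := `|nu| / mu.
have k0 : 0 <= k by rewrite divr_ge0.
have kmu : 0 <= nu + k * mu.
  by rewrite /k divfK ?gt_eqF//; have := ler_norm (- nu); rewrite normrN; lra.
pose c2 i := c' i + k * c i.
have c2E x : S x -> comb (j :: s) (fun i => if i == j then nu + k * mu else c2 i) f x =
    comb s c' f x + nu * f j x.
  move=> Sx; rewrite comb_cons//.
  have -> : comb s c2 f x = comb s c' f x + k * comb s c f x.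
    by rewrite /comb mulr_sumr -big_split/=; apply: eq_bigr => i _; rewrite /c2; ring.
  by transitivity (comb s c' f x + nu * f j x + k * (comb s c f x + mu * f j x));
    [ring|rewrite M0// mulr0 addr0].
exists (fun i => if i == j then nu + k * mu else c2 i) => [i|].
  by apply: upd_ge0 => // i'; rewrite addr_ge0// mulr_ge0.
apply: pos => [x Sx|]; first by rewrite c2E// nuge0.
case: (Sz) => Sz1 fz; exists z => //.
by rewrite c2E// fz mulr0 addr0 gt_eqF// c'pos.
Qed.

End theorem_of_the_alternative.

(** * Lebesgue functions and their pairing *)

Section Lp_functions.
Context {d : measure_display} {T : measurableType d} {R : realType}.
Variable mu : {measure set T -> \bar R}.

Lemma in_LfunP (p : \bar R) (f : T -> R) :
  f \in Lfun mu p <-> measurable_fun [set: T] f /\ finite_norm mu p f.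
Proof.
rewrite inE; split; last by move=> [mf ff]; apply/andP; rewrite !inE.
by move=> /andP[]; rewrite !inE.
Qed.

Lemma ae_le_Lfun (p : \bar R) (f g : T -> R) : (1 <= p)%E ->
  measurable_fun [set: T] f -> g \in Lfun mu p ->
  {ae mu, forall w, `|f w| <= `|g w|} -> f \in Lfun mu p.
Proof.
move=> p1 mf /in_LfunP[mg fg] fleg; apply/in_LfunP; split => //.
apply: le_lt_trans fg; rewrite unlock /Lnorm.
case: p p1 => [r r1| _|//].
  apply: gt0_ler_poweR;
    rewrite ?invr_ge0 ?in_itv /= ?leey ?andbT ?integral_ge0 ?(le_trans ler01)//.
  have mnorm (u : T -> R) : measurable_fun [set: T] u ->
      measurable_fun [set: T] (fun x => (`|u x| `^ r)%:E).
    move=> mu'; apply/measurable_EFinP.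
    by apply: (measurableT_comp (measurable_powR _)) => //; exact: measurableT_comp.
  apply: ae_ge0_le_integral => //.

  - exact: mnorm.

  - exact: mnorm.
  - apply: filterS fleg => x fgx _; rewrite lee_fin.
    by apply: ge0_ler_powR => //; rewrite (le_trans ler01).
case: ifP => // _; apply: le_ess_sup.
by apply: filterS fleg => x fgx; rewrite lee_fin.
Qed.

(** For p = oo the conjugate exponent is 1 and Hoelder's inequality is replaced by
the almost sure bound of x. If mu = 0 the L^oo norm is 0 by convention rather than an
essential supremum, and any bound holds almost surely. *)
Lemma integrable_pairing (p q : \bar R) (y x : T -> R) :
  (1 < p)%E -> (1 <= q)%E -> (p^-1 + q^-1 = 1)%E ->
  y \in Lfun mu q -> x \in Lfun mu p ->
  mu.-integrable [set: T] (EFin \o (fun w => y w * x w)).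
Proof.
move=> p1 q1 pq yq xp.
have [mx nx] := (in_LfunP _ _).1 xp.
have [my ny] := (in_LfunP _ _).1 yq.
have mxy : measurable_fun [set: T] (fun w => y w * x w) by exact: measurable_funM.
apply/Lfun1_integrable.
move: p p1 pq xp nx => [r|_|//].
- move=> r1 pq xp nx.
  have r0 : 0 < r by rewrite (lt_trans ltr01).
  move: q q1 pq yq ny => [s| _|//]; last first.
    rewrite invey adde0 => /eqP; rewrite inve_eq1 => /eqP re; by rewrite re ltxx in r1.
  move=> s1 pq yq ny.
  have s0 : 0 < s by rewrite (lt_le_trans ltr01).
  apply/in_LfunP; split => //; rewrite /finite_norm.
  have h : s^-1 + r^-1 = 1.
    by move: pq; rewrite !inver !gt_eqF// -EFinD => -[]; rewrite addrC.
  apply: (le_lt_trans (hoelder mu my mx s0 r0 h)).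
  by rewrite lte_mul_pinfty// ?ge0_fin_numE ?Lnorm_ge0.
- rewrite invey add0e => /eqP; rewrite inve_eq1 => /eqP q1' xp nx; subst q.
  have [B xB] : exists B, {ae mu, forall w, `|x w| <= B}.
    move: nx; rewrite /finite_norm unlock /Lnorm; case: ifPn => [_|].
      by move=> /ess_supr_bounded.
    rewrite -leNgt measure_le0 => /eqP mu0 _.
    by exists 0, [set: T]; split.
  apply: (@ae_le_Lfun _ _ (B *: y)) => //; first by rewrite rpredZ.
  apply: filterS xB => w xwB; rewrite /= normrM.
  change ((B *: y) w) with (B * y w).
  by rewrite normrM mulrC ler_wpM2r// (le_trans xwB) ?ler_norm.
Qed.

End Lp_functions.

Section pairing.
Context {d : measure_display} {T : measurableType d} {R : realType}.
Variables (mu : {measure set T -> \bar R}) (p q : \bar R).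
Hypotheses (p_gt1 : (1 < p)%E) (q_ge1 : (1 <= q)%E) (pq : (p^-1 + q^-1 = 1)%E).
Implicit Types x y : T -> R.
Local Notation "<[ y , x ]>" := (lp_pairing mu y x).

Lemma Lfun_lincomb (r : \bar R) (s t : R) x1 x2 : (1 <= r)%E ->
  x1 \in Lfun mu r -> x2 \in Lfun mu r -> s *: x1 + t *: x2 \in Lfun mu r.
Proof. by move=> r1 x1r x2r; rewrite rpredD ?rpredZ. Qed.

Lemma Lfun_sum (r : \bar R) (I : eqType) (s : seq I) (c : I -> R) (g : I -> T -> R) :
  (1 <= r)%E -> (forall i, i \in s -> g i \in Lfun mu r) ->
  (fun w => \sum_(i <- s) c i * g i w) \in Lfun mu r.
Proof.
move=> r1 gr.
have -> : (fun w => \sum_(i <- s) c i * g i w) = \sum_(i <- s) c i *: g i.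
  by apply/funext => w; rewrite fct_sumE.
by rewrite big_seq rpred_sum// => i /gr gir; rewrite rpredZ.
Qed.

Lemma lp_pairingDr y x1 x2 (s t : R) : y \in Lfun mu q ->
  x1 \in Lfun mu p -> x2 \in Lfun mu p ->
  <[y, s *: x1 + t *: x2]> = s * <[y, x1]> + t * <[y, x2]>.
Proof.
move=> yq x1p x2p.
have i1 := integrable_pairing p_gt1 q_ge1 pq yq x1p.
have i2 := integrable_pairing p_gt1 q_ge1 pq yq x2p.
have Zi (c : R) (f : T -> R) : mu.-integrable [set: T] (EFin \o f) ->
    mu.-integrable [set: T] (EFin \o (fun w => c * f w)).
  by move=> fi; apply: eq_integrable (integrableZl measurableT c fi).
rewrite /lp_pairing -!RintegralZl// -RintegralD//; [|exact: Zi|exact: Zi].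
apply: eq_Rintegral => w _.
change (y w * (s * x1 w + t * x2 w) = s * (y w * x1 w) + t * (y w * x2 w)).
by ring.
Qed.

Lemma lp_pairing_suml (I : eqType) (s : seq I) (c : I -> R) (g : I -> T -> R) x :
  (forall i, i \in s -> g i \in Lfun mu q) -> x \in Lfun mu p ->
  <[fun w => \sum_(i <- s) c i * g i w, x]> = \sum_(i <- s) c i * <[g i, x]>.
Proof.
move=> gq xp; elim: s gq => [|i s IH] gq.
  rewrite big_nil /lp_pairing; under eq_Rintegral do rewrite big_nil mul0r.
  by rewrite Rintegral_cst// mul0r.
have giq : g i \in Lfun mu q by apply: gq; exact: mem_head.
have gsq j : j \in s -> g j \in Lfun mu q by move=> js; apply: gq; rewrite inE js orbT.
rewrite big_cons -IH// /lp_pairing -RintegralZl//; last first.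
  exact: integrable_pairing giq xp.
rewrite -RintegralD//.
- by apply: eq_Rintegral => w _; rewrite big_cons; ring.
- apply: eq_integrable (integrableZl measurableT (c i)
    (integrable_pairing p_gt1 q_ge1 pq giq xp)) => //.
- exact: (integrable_pairing p_gt1 q_ge1 pq (Lfun_sum c q_ge1 gsq) xp).
Qed.

End pairing.

(** * Weights and undominated functions *)

Section measure_constructions.
Context {d : measure_display} {T : measurableType d} {R : realType}.

(** The series of the c_k 1_(A_k) has integral at most 1, so it is finite almost
everywhere; its finite part [psi] dominates the partial sums there. *)
Lemma integrable_indic_series (mu : {measure set T -> \bar R})
    (A : nat -> set T) (c : nat -> R) :
  (forall k, measurable (A k)) -> (forall k, 0 <= c k) ->
  (forall k, ((c k)%:E * mu (A k) <= ((2 ^ k.+1)%:R^-1)%:E)%E) ->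
  exists psi : T -> R, [/\ forall w, 0 <= psi w,
    measurable_fun [set: T] psi,
    mu.-integrable [set: T] (EFin \o psi) &
    {ae mu, forall w, forall n, \sum_(k < n) c k * \1_(A k) w <= psi w}].
Proof.
move=> mA c0 cA.
pose F k w : \bar R := (c k * \1_(A k) w)%:E.
have mF k : measurable_fun [set: T] (F k).
  by apply/measurable_EFinP; exact: measurable_funM.
have F0 k w : (0 <= F k w)%E by rewrite lee_fin mulr_ge0.
pose S w := (\sum_(k <oo) F k w)%E.
have S0 w : (0 <= S w)%E by apply: nneseries_ge0 => k _ _.
have mS : measurable_fun [set: T] S by apply: ge0_emeasurable_sum => k.
have iS : mu.-integrable [set: T] S.
  apply/integrableP; split => //.
  under eq_integral do rewrite gee0_abs//.
  rewrite integral_nneseries//.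
  apply: (@le_lt_trans _ _ (\sum_(k <oo) (1 / (2 ^ k.+1)%:R)%:E)%E).
    apply: lee_nneseries => k _; first by move=> _; exact: integral_ge0.
    rewrite div1r.
    under eq_integral do rewrite /F EFinM.
    rewrite ge0_integralZl_EFin//.
      by rewrite integral_indic// setIT.
    by apply/measurable_EFinP.
  by apply: (le_lt_trans (epsilon_trick0 xpredT ler01)); rewrite ltry.
exists (fine \o S); split.
- by move=> w; exact: fine_ge0.
- exact: measurableT_comp.
- apply: (le_integrable _ _ _ iS) => //.
    by apply/measurable_EFinP; exact: measurableT_comp.
  by move=> w _ /=; case: (S w) => [r| |] //=; rewrite ?normr0 ?abse0 ?leey.
- apply: filterS (integrable_ae measurableT iS) => w /(_ I) fS n.
  rewrite -lee_fin fineK// -sumEFin.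
  have := @nneseries_lim_ge R (F^~ w) xpredT 0 n.
  by rewrite big_mkord; apply.
Qed.

(** One weight that serves all exponents: truncating an integrable function at 1
places it in every L^p, since e^p <= e when 0 <= e <= 1. *)
Lemma ae_positive_Lfun (mu : {sigma_finite_measure set T -> \bar R}) :
  exists e : T -> R, [/\ forall w, 0 <= e w,
    {ae mu, forall w, 0 < e w} &
    forall p : \bar R, (1 <= p)%E -> e \in Lfun mu p].
Proof.
have [F TF mF] := sigma_finiteT mu.
pose c k : R := ((2 ^ k.+1)%:R * (1 + fine (mu (F k))))^-1.
have c_gt0 k : 0 < c k.
  rewrite invr_gt0 mulr_gt0// ?ltr0n ?expn_gt0//.
  by rewrite ltr_pwDl// fine_ge0.
have [|k|k|psi [psi0 mpsi ipsi psiF]] := @integrable_indic_series mu F c.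
- by move=> k; case: (mF k).
- exact/ltW.
- have [mFk Fkoo] := mF k.
  rewrite -[X in (_ * X)%E]fineK ?ge0_fin_numE// -EFinM lee_fin /c.
  rewrite invfM -mulrA ger_pMr ?invr_gt0 ?ltr0n ?expn_gt0//.
  rewrite mulrC ler_pdivrMr ?mul1r ?ler_wpDl ?lerDr//.
  by rewrite ltr_pwDl// fine_ge0.
pose e w := Num.min 1 (psi w).
have e0 w : 0 <= e w by rewrite /e le_min ler01 psi0.
have me : measurable_fun [set: T] e by exact: measurable_minr.
exists e; split => //.
- apply: filterS psiF => w psiw; rewrite /e lt_min ltr01/=.
  have [k _ Fkw] : (\bigcup_i F i) w by rewrite -TF.
  apply: lt_le_trans (psiw k.+1); rewrite big_ord_recr/= indicE mem_set// mulr1.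
  by rewrite ltr_wpDl// sumr_ge0// => i _; rewrite mulr_ge0// ltW.
- move=> [r r1|_|//]; apply/in_LfunP; split => //; rewrite /finite_norm unlock /Lnorm.
    apply: poweR_lty; apply: (@le_lt_trans _ _ (\int[mu]_w (psi w)%:E)%E); last first.
      apply: integrable_lty => //.
    apply: ge0_le_integral => //.
    + by move=> w _; rewrite lee_fin powR_ge0.
    + apply/measurable_EFinP; apply: (measurableT_comp (measurable_powR _)) => //.
      exact: measurableT_comp.
    + exact/measurable_EFinP.
    + move=> w _; rewrite /= lee_fin ger0_norm//.
      apply: (@le_trans _ _ (e w)); last by rewrite /e ge_min lexx orbT.
      have [->|ew] := eqVneq (e w) 0; first by rewrite powR0// gt_eqF// (lt_le_trans ltr01).
      by apply: ge1r_powR => //; rewrite lt_neqAle eq_sym ew e0/= /e ge_min lexx.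
  case: ifP => _ //; apply: le_lt_trans (ltry 1); apply/ess_supP.
  by apply: nearW => w /=; rewrite lee_fin ger0_norm// /e ge_min lexx.
Qed.

(** A subset of strictly smaller positive measure exists, and it or its complement
in A has at most half the measure. *)
Lemma nonatomic_half (mu : {measure set T -> \bar R}) (A : set T) :
  nonatomic mu -> measurable A -> (0 < mu A < +oo)%E ->
  exists B, [/\ measurable B, B `<=` A, (0 < mu B)%E & (2%:E * mu B <= mu A)%E].
Proof.
move=> na mA /andP[A0 Aoo].
have [B [mB BA BltA B0]] : exists B, [/\ measurable B, B `<=` A,
    (mu B < mu A)%E & mu B <> 0%E].
  apply: contrapT => H; apply: (na A); split => // B mB BA BltA.
  by apply: contrapT => B0; apply: H; exists B.
have {}B0 : (0 < mu B)%E by rewrite lt0e measure_ge0 andbT; exact/eqP.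
have mAB : measurable (A `\` B) by exact: measurableD.
have AE : mu A = (mu B + mu (A `\` B))%E.
  by rewrite -measureU// ?setDUK// setDIK.
have Boo : mu B \is a fin_num by rewrite ge0_fin_numE// (lt_trans BltA).
have ABoo : mu (A `\` B) \is a fin_num.
  rewrite ge0_fin_numE// (le_lt_trans _ Aoo)// le_measure ?inE//.
have [h|h] := leP (mu B) (mu (A `\` B)).
  by exists B; split => //; rewrite AE mule_natl mule2n leeD2l.
exists (A `\` B); split => //.
  by move: BltA; rewrite AE -[X in (X < _)%E]adde0 lteD2lE.
by rewrite AE mule_natl mule2n leeD2r// ltW.
Qed.

Lemma finite_bounded_subset (mu : {sigma_finite_measure set T -> \bar R})
    (D : set T) (M : T -> R) : measurable D -> mu D != 0%E ->
  measurable_fun [set: T] M ->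
  exists A N, [/\ measurable A, A `<=` D, (0 < mu A < +oo)%E &
    forall w, A w -> M w <= N].
Proof.
move=> mD D0 mM.
have [F [TF ndF mF]] := (sigma_finiteP _ _).1 (sigma_finiteT mu).
pose G k := D `&` F k `&` [set w | M w <= k%:R].
have mG k : measurable (G k).
  apply: measurableI; first by apply: measurableI => //; case: (mF k).
  by rewrite -preimage_itvNyc -[X in measurable X]setTI; exact: mM.
have DG : D = \bigcup_k G k.
  apply/seteqP; split=> [w Dw|w [k _ [[]]//]].
  have [i _ Fiw] : (\bigcup_i F i) w by rewrite -TF.
  pose k := maxn i (Num.truncn (M w)).+1.
  exists k => //; split.
    split => //; have /subsetPset := ndF _ _ (leq_maxl i (Num.truncn (M w)).+1).
    exact.
  rewrite /= ltW// (lt_le_trans (truncnS_gt _))// ler_nat.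
  exact: leq_maxr.
have [k Gk] : exists k, mu (G k) != 0%E.
  apply: contrapT => /forallNP H; move/negP: D0; apply; apply/eqP.
  apply/negligibleP => //; rewrite DG; apply: negligible_bigcup => k.
  by apply/negligibleP => //; apply/eqP/negPn/negP/H.
exists (G k), k%:R; split => //.
- by move=> w [[]].
- rewrite lt0e Gk measure_ge0/=; have [mFk] := mF k; apply: le_lt_trans.
  by rewrite le_measure ?inE// => w [[]].
- by move=> w [].
Qed.

(** Halving repeatedly a set A_0 of finite measure on which M is bounded gives
decreasing sets A_k of positive measure at most 2^-k mu(A_0). The sum of their
indicators is integrable but exceeds k on A_k, so its q-th root is an unbounded
element of L^q. The weights c only make the integral at most 1. *)
Lemma Lfun_not_dominated (mu : {sigma_finite_measure set T -> \bar R})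
    (q : \bar R) (D : set T) (M : T -> R) : (1 <= q)%E -> (q < +oo)%E ->
  nonatomic mu -> measurable D -> mu D != 0%E -> measurable_fun [set: T] M ->
  exists phi : T -> R, [/\ forall w, 0 <= phi w, phi \in Lfun mu q &
    forall C, 0 <= C -> ~ {ae mu, forall w, D w -> phi w <= C * M w}].
Proof.
move: q => [r r1 _|//|//] na mD D0 mM.
have r0 : 0 < r by rewrite (lt_le_trans ltr01).
have [A0 [N [mA0 A0D A0fin MN]]] := finite_bounded_subset mD D0 mM.
pose P A := measurable A /\ (0 < mu A < +oo)%E.
have /choice[half Hhalf] : forall A, exists B, P A ->
    [/\ P B, B `<=` A & (2%:E * mu B <= mu A)%E].
  move=> A; have [[mA Afin]|nA] := pselect (P A); last by exists A.
  have [B [mB BA B0 BA2]] := nonatomic_half na mA Afin.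
  exists B => _; split => //; split => //; rewrite B0/=.
  case/andP: Afin => _; apply: le_lt_trans.
  by rewrite le_measure ?inE.
pose A k := iter k half A0.
have PA k : P (A k) by elim: k => [//|k IH]; case: (Hhalf _ IH).
have AS k : A k.+1 `<=` A k by case: (Hhalf _ (PA k)).
have Amon i j : (i <= j)%N -> A j `<=` A i.
  elim: j => [|j IH]; first by rewrite leqn0 => /eqP ->.
  rewrite leq_eqVlt => /predU1P[-> //|]; rewrite ltnS => /IH.
  exact: subset_trans (AS j).
pose a := fine (mu A0).
have aE : mu A0 = a%:E by case/andP: A0fin => ? ?; rewrite /a fineK// ge0_fin_numE.
have a0 : 0 < a by rewrite -lte_fin -aE; case/andP: A0fin.
have muA k : (mu (A k) <= (a / (2 ^ k)%:R)%:E)%E.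
  elim: k => [|k IH]; first by rewrite expn0 divr1 /= aE.
  have [_ _] := Hhalf _ (PA k); rewrite -/(A k.+1) => h.
  have {IH}h := le_trans h IH.
  rewrite -(@lee_pmul2l _ 2%:E)// (le_trans h)// -EFinM lee_fin.
  rewrite expnS natrM le_eqVlt; apply/orP; left; apply/eqP; field.
  by rewrite pnatr_eq0 expn_eq0.
pose c : nat -> R := fun=> (2 * a)^-1.
have c0 k : 0 < c k by rewrite invr_gt0 mulr_gt0.
have [|k|k|psi [psi0 mpsi ipsi psiA]] := @integrable_indic_series mu A c.
- by move=> k; case: (PA k).
- exact/ltW.
- apply: (le_trans (lee_wpmul2l _ (muA k))); first by rewrite lee_fin ltW.
  rewrite -EFinM lee_fin /c expnS natrM !invfM le_eqVlt; apply/orP; left.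
  by apply/eqP; field; rewrite pnatr_eq0 expn_eq0 (gt_eqF a0).
exists (fun w => psi w `^ r^-1); split.
- by move=> w; exact: powR_ge0.
- apply/in_LfunP; split.
    by apply: (measurableT_comp (measurable_powR _)).
  rewrite /finite_norm unlock /Lnorm; apply: poweR_lty.
  under eq_integral do rewrite /= ger0_norm ?powR_ge0// -powRrM mulVf ?gt_eqF// powRr1//.
  exact: integrable_lty.
move=> C C_ge0 H.
(* on A k the sum is at least k / (2 a), which beats the q-th power of the bound *)
pose k := (Num.truncn (2 * a * (C * `|N|) `^ r)).+1.
have [mAk /andP[Ak0 _]] := PA k.
suff : mu (A k) = 0%E by move=> Ak; rewrite Ak ltxx in Ak0.
apply/negligibleP => //.
have HI : {ae mu, forall w, (D w -> psi w `^ r^-1 <= C * M w) /\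
  (forall n, \sum_(k < n) c k * \1_(A k) w <= psi w)} by exact: filterI.
apply: (negligibleS _ HI).
move=> w Akw [/(_ (A0D _ (Amon 0%N k isT _ Akw))) h1 /(_ k) h2].
have : (C * `|N|) `^ r < psi w.
  apply: lt_le_trans h2.
  rewrite (eq_bigr (fun=> (2 * a)^-1)); last first.
    by move=> i _; rewrite indicE mem_set ?mulr1//; apply: (Amon _ _ (ltnW (ltn_ord i))).
  rewrite sumr_const card_ord -[ltRHS]mulr_natl ltr_pdivlMr ?mulr_gt0//.
  by rewrite mulrC truncnS_gt.
rewrite ltNge => /negP; apply.
have : psi w `^ r^-1 <= C * `|N|.
  apply: (le_trans h1); rewrite ler_wpM2l//.
  apply: (le_trans _ (ler_norm _)); apply: MN; exact: (Amon 0%N k isT).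
move=> h3; have : (psi w `^ r^-1) `^ r <= (C * `|N|) `^ r.
  by apply: (ge0_ler_powR (ltW r0)) => //; rewrite nnegrE ?powR_ge0 ?mulr_ge0.
by rewrite -powRrM mulVf ?gt_eqF// powRr1.
Qed.

End measure_constructions.

(** * Moving inside a box *)

Section box.
Context {R : realType}.
Implicit Types (e x : R) (a b : \bar R).

(** An admissible upward move from [x] below [b]: half of the gap, so that strict
inequality is kept, capped by [e] so that the resulting function stays in L^p and an
infinite bound is harmless. Applied to [- x] and [- a] it measures the downward move
above [a]. *)
Definition room e x b : R := fine (mine e%:E ((b - x%:E) * 2^-1%:E))%E.

Lemma room_bounds e x b : 0 <= e -> (x%:E <= b)%E ->
  0 <= room e x b <= e /\ ((x + room e x b)%:E <= b)%E.
Proof.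
move=> e0; case: b => [r| |//]; rewrite /room.
  rewrite lee_fin => xr; rewrite -EFinB -EFinM -EFin_min/= le_min e0/= ge_min lexx/=.
  have : Num.min e ((r - x) / 2) <= (r - x) / 2 by rewrite ge_min lexx orbT.
  by rewrite lee_fin => H; split; [lra|lra].
by move=> _; rewrite addye// gt0_mulye ?lte_fin// miney lexx e0 leey.
Qed.

Lemma room_gt0 e x b : 0 < e -> (x%:E < b)%E ->
  0 < room e x b /\ ((x + room e x b)%:E < b)%E.
Proof.
move=> e0; case: b => [r| |//]; rewrite /room.
  rewrite lte_fin => xr; rewrite -EFinB -EFinM -EFin_min/= lt_min e0/=.
  have : Num.min e ((r - x) / 2) <= (r - x) / 2 by rewrite ge_min lexx orbT.
  by rewrite lte_fin => H; split; lra.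
by move=> _; rewrite addye// gt0_mulye ?lte_fin// miney e0 ltry.
Qed.

Lemma room_down_bounds e x a : 0 <= e -> (a <= x%:E)%E ->
  0 <= room e (- x) (- a) <= e /\ (a <= (x - room e (- x) (- a))%:E)%E.
Proof.
move=> e0 ax; have [|h1 h2] := @room_bounds e (- x) (- a)%E e0.
  by rewrite EFinN leeN2.
by split => //; rewrite -leeN2 -EFinN opprB addrC.
Qed.

Lemma room_down_gt0 e x a : 0 < e -> (a < x%:E)%E -> 0 < room e (- x) (- a).
Proof. by move=> e0 ax; apply: (room_gt0 e0 _).1; rewrite EFinN lteN2. Qed.

(** The midpoint of the endpoints of the two admissible moves. When [a] < [b] at
least one of them is nontrivial, which keeps it off both bounds even if [x] is at one
of them. *)
Definition nudge e x a b : R := x + (room e x b - room e (- x) (- a)) / 2.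

Lemma nudge_bounds e x a b : 0 < e -> (a < b)%E -> (a <= x%:E <= b)%E ->
  `|nudge e x a b - x| <= e /\ (a < (nudge e x a b)%:E < b)%E.
Proof.
move=> e0 ab /andP[ax xb].
have [/andP[u0 ue] ub] := room_bounds (ltW e0) xb.
have [/andP[l0 le] la] := room_down_bounds (ltW e0) ax.
rewrite /nudge; set u := room e x b in u0 ue ub *; set l := room _ _ _ in l0 le la *.
split.
  by rewrite (addrC x) addrK ler_norml; apply/andP; split; lra.
have : 0 < u \/ 0 < l.
  have [xltb|bx] := ltP (x%:E) b; first by left; apply: (room_gt0 e0 xltb).1.
  by right; apply: room_down_gt0 => //; rewrite (lt_le_trans ab).
move=> ul; apply/andP; split.
  apply: (le_lt_trans la); rewrite lte_fin; lra.
apply: lt_le_trans ub; rewrite lte_fin; lra.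
Qed.

Lemma convex_combination_interior (x y t : R) a b : 0 < t -> t <= 1 ->
  (a < x%:E < b)%E -> (a <= y%:E <= b)%E -> (a < (t * x + (1 - t) * y)%:E < b)%E.
Proof.
move=> t0 t1 /andP[ax xb] /andP[ay yb]; apply/andP; split.
  case: a ax ay => [r| |] //=; rewrite ?ltNyr// ?lte_fin ?lee_fin => ax ay; nra.
case: b xb yb => [r| |] //=; rewrite ?ltry// ?lte_fin ?lee_fin => xb yb; nra.
Qed.

Lemma measurable_room d (T : measurableType d) (e x : T -> R) (b : T -> \bar R) :
  measurable_fun [set: T] e -> measurable_fun [set: T] x ->
  measurable_fun [set: T] b ->
  measurable_fun [set: T] (fun w => room (e w) (x w) (b w)).
Proof.
move=> me mx mb; apply: measurableT_comp => //.
apply: measurable_mine; first exact/measurable_EFinP.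
apply: emeasurable_funM => //; apply: emeasurable_funB => //.
exact/measurable_EFinP.
Qed.

End box.

(** * Rigidity in the absence of interior points *)

Section rigidity.
Context {d : measure_display} {T : measurableType d} {R : realType}.
Variables (mu : {sigma_finite_measure set T -> \bar R}) (p q : \bar R).
Hypotheses (p_gt1 : (1 < p)%E) (q_ge1 : (1 <= q)%E) (pq : (p^-1 + q^-1 = 1)%E).
Variables (xa xb : T -> \bar R).
Hypotheses (mxa : measurable_fun [set: T] xa) (mxb : measurable_fun [set: T] xb).
Implicit Types x y G : T -> R.
Local Notation "<[ y , x ]>" := (lp_pairing mu y x).
Local Notation box := (box_feasible mu p xa xb).

Lemma Rintegral_le0_ae_eq0 (h : T -> R) : mu.-integrable [set: T] (EFin \o h) ->
  {ae mu, forall w, 0 <= h w} -> \int[mu]_w h w <= 0 -> {ae mu, forall w, h w = 0}.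
Proof.
move=> ih h0 inth.
have mh := measurable_int mu ih.
have : (\int[mu]_w `|(EFin \o h) w| = 0)%E.
  have habs : (\int[mu]_w `|(EFin \o h) w| = \int[mu]_w (h w)%:E)%E.
    apply: ae_eq_integral => //; first exact: measurableT_comp.
    by apply: filterS h0 => w hw _; rewrite /= ger0_norm.
  have int_ge0 : (0 <= \int[mu]_w (h w)%:E)%E by rewrite -habs integral_ge0.
  rewrite habs -[LHS]fineK; last exact: integrable_fin_num.
  by congr EFin; apply/eqP; rewrite eq_le inth/= fine_ge0.
move=> /(ae_eq_integral_abs mu measurableT mh).
by apply: filterS => w /(_ I) [].
Qed.

Lemma lp_pairing_ae0 (y x : T -> R) : y \in Lfun mu q -> x \in Lfun mu p ->
  {ae mu, forall w, y w = 0} -> <[y, x]> = 0.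
Proof.
move=> yq xp y0; have iyx := integrable_pairing p_gt1 q_ge1 pq yq xp.
have -> : <[y, x]> = \int[mu]_(w in [set: T]) (cst 0 w).
  congr fine; apply: ae_eq_integral => //;
    [exact: measurable_int iyx|exact/measurable_EFinP|].
  by apply: filterS y0 => w y0 _; rewrite y0 mul0r.
by rewrite Rintegral_cst// mul0r.
Qed.

Let p_ge1 : (1 <= p)%E. Proof. exact: ltW. Qed.

(** Moving x down where G > 0 and up where G < 0, as far as the box permits, can
only decrease <G, x>; minimality forces this decrease to be zero, so there was no room
to move. *)
Lemma box_minimizer_complementarity G x : G \in Lfun mu q -> box x ->
  (forall y, box y -> <[G, x]> <= <[G, y]>) ->
  {ae mu, forall w, (0 < G w -> xa w = (x w)%:E) /\ (G w < 0 -> (x w)%:E = xb w)}.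
Proof.
move=> Gq [xp xab] minx.
have [e [e0 ae_e ep]] := ae_positive_Lfun mu.
have [mG _] := (in_LfunP _ _ _).1 Gq.
have [mx _] := (in_LfunP _ _ _).1 xp.
have [me _] := (in_LfunP _ _ _).1 (ep p p_ge1).
pose up w := room (e w) (x w) (xb w).
pose down w := room (e w) (- x w) (- xa w).
have mup : measurable_fun [set: T] up by exact: measurable_room.
have mdown : measurable_fun [set: T] down.
  apply: measurable_room => //; first exact: measurable_funN.
  exact: measurableT_comp.
pose v w := if 0 < G w then down w else if G w < 0 then - up w else 0.
have mv : measurable_fun [set: T] v.
  apply: measurable_fun_ifT => //; first exact: measurable_fun_ltr.
  apply: measurable_fun_ifT => //; first exact: measurable_fun_ltr.
  exact: measurable_funN.
have vp : v \in Lfun mu p.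
  apply: (ae_le_Lfun p_ge1 mv (ep p p_ge1)).
  apply: filterS xab => w /andP[ax xb'].
  have [/andP[u0 ue] _] := room_bounds (e0 w) xb'.
  have [/andP[l0 le] _] := room_down_bounds (e0 w) ax.
  rewrite (ger0_norm (e0 w)) /v.
  by case: ifP => _; [rewrite ger0_norm|case: ifP => _; rewrite ?normr0 ?normrN ?ger0_norm].
have boxv : box (1 *: x + (-1) *: v).
  split; first exact: Lfun_lincomb.
  apply: filterS xab => w /andP[ax xb'].
  change ((1 *: x + (-1) *: v) w) with (1 * x w + -1 * v w); rewrite mul1r mulN1r.
  have [/andP[u0 ue] ub] := room_bounds (e0 w) xb'.
  have [/andP[l0 le] la] := room_down_bounds (e0 w) ax.
  rewrite /v; case: ifP => _.
    by rewrite la/= (le_trans _ xb')// lee_fin gerDl oppr_le0.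
  case: ifP => _; last by rewrite subr0 ax.
  by rewrite opprK ub andbT (le_trans ax)// lee_fin lerDl.
have Gv_le0 : <[G, v]> <= 0.
  have := minx _ boxv; rewrite (lp_pairingDr p_gt1 q_ge1 pq)//.
  by rewrite mul1r mulN1r lerDl oppr_ge0.
have Gv0 : {ae mu, forall w, G w * v w = 0}.
  apply: Rintegral_le0_ae_eq0 => //; first exact: integrable_pairing Gq vp.
  apply: filterS xab => w /andP[ax xb'].
  have [/andP[u0 _] _] := room_bounds (e0 w) xb'.
  have [/andP[l0 _] _] := room_down_bounds (e0 w) ax.
  rewrite /v; case: ifPn => [G0|_]; first by rewrite mulr_ge0// ltW.
  by case: ifPn => [G0|_]; rewrite ?mulr0// mulrN oppr_ge0 mulr_le0_ge0// ltW.
apply: filterS3 ae_e xab Gv0 => w ew /andP[ax xb'] /eqP; rewrite mulf_eq0 => Gv0.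
split=> Gw.
  move: ax; rewrite le_eqVlt => /predU1P[//|/(room_down_gt0 ew)].
  by move: Gv0; rewrite -/(down w) /v Gw gt_eqF//= => /eqP ->; rewrite ltxx.
move: xb'; rewrite le_eqVlt => /predU1P[//|/(room_gt0 ew)[]].
move: Gv0; rewrite /v Gw lt_gtF//= lt_eqF//= oppr_eq0 => /eqP up0.
by rewrite -/(up w) up0 ltxx.
Qed.

(** The theorem of the alternative, applied to the points strictly inside the box,
gives a combination that is positive there and nonnegative on the box, while it is
nonpositive at feasible points; hence every feasible point minimizes <G, .> over the
box. G is nonzero because the combination, being positive strictly inside and
nonpositive at [x0], is not constant. *)
Theorem no_interior_point_rigidity (I : finType) (g : I -> T -> R) (b : I -> R) x0 :
  {ae mu, forall w, (xa w < xb w)%E} -> (forall i, g i \in Lfun mu q) ->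
  box x0 -> (forall i, <[g i, x0]> <= b i) ->
  ~ (exists2 x, x \in Lfun mu p /\ {ae mu, forall w, (xa w < (x w)%:E < xb w)%E} &
       forall i, <[g i, x]> <= b i) ->
  exists G, [/\ G \in Lfun mu q, ~ {ae mu, forall w, G w = 0} &
    forall x, box x -> (forall i, <[g i, x]> <= b i) ->
    {ae mu, forall w, (0 < G w -> xa w = (x w)%:E) /\ (G w < 0 -> (x w)%:E = xb w)}].
Proof.
move=> xab gq boxx0 x0b nosol.
pose S : set (T -> R) :=
  [set x | x \in Lfun mu p /\ {ae mu, forall w, (xa w < (x w)%:E < xb w)%E}].
pose s := index_enum I.
pose f i x := <[g i, x]> - b i.
pose G (c : I -> R) w := \sum_(i <- s) c i * g i w.
pose gam (c : I -> R) := \sum_(i <- s) c i * b i.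
have Gq c : G c \in Lfun mu q by exact: Lfun_sum.
have combE c x : x \in Lfun mu p -> comb s c f x = <[G c, x]> - gam c.
  move=> xp; rewrite (lp_pairing_suml p_gt1 q_ge1 pq)// /gam -sumrB.
  by apply: eq_bigr => i _; rewrite /f mulrBr.
have boxp x : box x -> x \in Lfun mu p by case.
have Sbox x : S x -> box x.
  by move=> [xp xab']; split => //; apply: filterS xab' => w /andP[/ltW-> /ltW->].
have affbox i : affine_on box (f i).
  move=> x y t [xp _] [yp _] _; rewrite /f (lp_pairingDr p_gt1 q_ge1 pq)//; ring.
have box_to_S x y t : S x -> box y -> 0 < t -> t <= 1 -> S (t *: x + (1 - t) *: y).
  move=> [xp xi] [yp yi] t0 t1; split; first exact: Lfun_lincomb.
  apply: filterS2 xi yi => w xw yw.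
  change ((t *: x + (1 - t) *: y) w) with (t * x w + (1 - t) * y w).
  exact: convex_combination_interior.
have cS : convex_subset S.
  move=> x y t Sx Sy /andP[t0 t1]; have [t_gt0|] := ltP 0 t.
    by apply: box_to_S => //; exact: Sbox.
  move=> t_le0; have -> : t = 0 by apply/eqP; rewrite eq_le t_le0.
  by rewrite scale0r add0r subr0 scale1r.
have affS i : i \in s -> affine_on S (f i).
  by move=> _; exact: (affine_on_sub Sbox).
(* nudging x0 off the bounds produces a point of S *)
have [z Sz] : exists z, S z.
  have [e [e0 ae_e ep]] := ae_positive_Lfun mu.
  have [x0p x0i] := boxx0.
  have [mx _] := (in_LfunP _ _ _).1 x0p.
  have [me _] := (in_LfunP _ _ _).1 (ep p p_ge1).
  pose v w := (room (e w) (x0 w) (xb w) - room (e w) (- x0 w) (- xa w)) / 2.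
  have nudgeE w : nudge (e w) (x0 w) (xa w) (xb w) = (1 *: x0 + 1 *: v) w.
    change ((1 *: x0 + 1 *: v) w) with (1 * x0 w + 1 * v w).
    by rewrite !mul1r.
  exists (1 *: x0 + 1 *: v); split; last first.
    apply: filterS3 ae_e xab x0i => w ew abw xw; rewrite -nudgeE.
    by case: (nudge_bounds ew abw xw).
  apply: Lfun_lincomb => //; apply: (ae_le_Lfun p_ge1 _ (ep p p_ge1)).
    apply: measurable_funM => //; apply: measurable_funB; first exact: measurable_room.
    apply: measurable_room => //; first exact: measurable_funN.
    exact: measurableT_comp.
  apply: filterS3 ae_e xab x0i => w ew abw xw; rewrite (ger0_norm (e0 w)).
  have [+ _] := nudge_bounds ew abw xw.
  by rewrite /nudge addrAC subrr add0r.
have extend c x : S x -> (forall y, S y -> 0 < comb s c f y) ->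
    forall y, box y -> 0 <= comb s c f y.
  move=> Sx cpos y yb; apply: (@segment_limit_ge0 _ _ (comb s c f x)) => t t0 t1.
  rewrite -(affine_on_comb c (fun i _ => affbox i) (Sbox _ Sx) yb).
    exact/cpos/box_to_S.
  by rewrite t1 ltW.
(* a functional minimal at a point strictly inside the box has density zero *)
have unS : unsupported S s f.
  move=> c cge0 x Sx cx0 y Sy.
  have xp := boxp _ (Sbox _ Sx); have yp := boxp _ (Sbox _ Sy).
  have cbox u : box u -> 0 <= comb s c f u.
    move=> ub; have h : 0 <= (2^-1 : R) <= 1 by lra.
    have := cge0 (2^-1 *: x + (1 - 2^-1) *: u).
    rewrite (affine_on_comb c (fun i _ => affbox i) (Sbox _ Sx) ub)// cx0 mulr0 add0r.
    rewrite pmulr_rge0; last lra.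
    by apply; apply: box_to_S => //; lra.
  have minx u : box u -> <[G c, x]> <= <[G c, u]>.
    move=> ub; have := cbox u ub; have := cx0.
    by rewrite !combE ?(boxp u)//; lra.
  have G0 : {ae mu, forall w, G c w = 0}.
    have Gcomp := box_minimizer_complementarity (Gq c) (Sbox _ Sx) minx.
    apply: filterS2 Gcomp Sx.2 => w [Gpos Gneg] /andP[ax xb'].
    apply/eqP; case: ltgtP => // Gw.
      by move: xb'; rewrite (Gneg Gw) ltxx.
    by move: ax; rewrite (Gpos Gw) ltxx.
  move: cx0; rewrite !combE//.
  by rewrite (lp_pairing_ae0 (Gq c) xp G0) (lp_pairing_ae0 (Gq c) yp G0).
have [|c c0 cpos] := alternative (index_enum_uniq I) cS (ex_intro _ z Sz) affS unS.
  move=> [x Sx fx]; apply: nosol; exists x => // i.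
  by rewrite -subr_le0; apply: fx; rewrite mem_index_enum.
exists (G c); split => //.
  (* if G vanished, the combination would be constant on the box *)
  move=> G0; have := cpos z Sz.
  have -> : comb s c f z = comb s c f x0.
    have zp := boxp _ (Sbox _ Sz); have x0p := boxp _ boxx0.
    by rewrite !combE// (lp_pairing_ae0 (Gq c) zp G0) (lp_pairing_ae0 (Gq c) x0p G0).
  rewrite ltNge => /negP; apply; apply: sumr_le0 => i _.
  by rewrite mulr_ge0_le0// subr_le0.
move=> x xb' xcon; apply: box_minimizer_complementarity => // y yb.
have : comb s c f x <= 0 by apply: sumr_le0 => i _; rewrite mulr_ge0_le0// subr_le0.
have := extend c z Sz cpos y yb.
by rewrite !combE ?(boxp x) ?(boxp y)//; lra.
Qed.

End rigidity.

(** * Nonexistence of multipliers *)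

Lemma ler_norm_sum_mul (R : realType) (n : nat) (P : pred 'I_n) (c u : 'I_n -> R) :
  `|\sum_(i < n | P i) c i * u i| <= (\sum_(i < n) `|c i|) * \sum_(i < n) `|u i|.
Proof.
apply: (le_trans (ler_norm_sum _ _ _)).
rewrite mulr_suml big_mkcond/=; apply: ler_sum => i _.
have h : `|c i| * `|u i| <= `|c i| * \sum_(j < n) `|u j|.
  by rewrite ler_wpM2l// (bigD1 i)//= lerDl sumr_ge0.
by case: ifP => _; rewrite ?normrM// mulr_ge0// sumr_ge0.
Qed.

Theorem corollary4p6 (R : realType) (d : measure_display)
    (T : measurableType d) (mu : {sigma_finite_measure set T -> \bar R})
    (p q : \bar R) (hp : (1 <= p)%E) (hq : (1 <= q)%E)
    (hpq : (p^-1 + q^-1 = 1)%E)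
    (xa xb : T -> \bar R)
    (mxa : measurable_fun [set: T] xa) (mxb : measurable_fun [set: T] xb)
    (n m : nat) (g : 'I_n -> T -> R) (h : 'I_m -> T -> R)
    (hg : forall i, g i \in Lfun mu q) (hh : forall j, h j \in Lfun mu q)
    (a : 'I_n -> R) (b : 'I_m -> R)
    (xab : {ae mu, forall w, (xa w < xb w)%E})
    (no_slater : ~ exists xhat, slater_point mu p xa xb g h a b xhat)
    (p_gt1 : (1 < p)%E) (mu_nonatomic : nonatomic mu) :
  forall xbar : T -> R, (box_feasible mu p xa xb `&` linear_feasible mu p g h a b) xbar ->
  exists2 F : T -> R, F \in Lfun mu q &
    (forall x, (box_feasible mu p xa xb `&` linear_feasible mu p g h a b) x ->
       lp_pairing mu F xbar <= lp_pairing mu F x) /\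
    ~ exists zeta alpha beta,
        lagrange_multiplier mu xa xb g h a q F xbar zeta alpha beta.
Proof.
move=> xbar [boxbar [_ gbar hbar]].
have p_ge1 := ltW p_gt1.
have q_lty : (q < +oo)%E.
  rewrite ltey; apply/eqP => qy; move: hpq p_gt1; rewrite qy invey adde0.
  by move=> /eqP; rewrite inve_eq1 => /eqP ->; rewrite ltxx.
(* an equation is the conjunction of two inequalities, with densities h j and - h j *)
pose I : finType := ('I_n + ('I_m + 'I_m))%type.
pose gh (i : I) : T -> R := match i with
  | inl i => g i | inr (inl j) => h j | inr (inr j) => - h j end.
pose ab (i : I) : R := match i with
  | inl i => a i | inr (inl j) => b j | inr (inr j) => - b j end.
have ghq i : gh i \in Lfun mu q by case: i => [i|[j|j]] //=; rewrite rpredN.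
have pairingN j x : x \in Lfun mu p ->
    lp_pairing mu (- h j) x = - lp_pairing mu (h j) x.
  move=> xp; rewrite -[RHS]mulN1r /lp_pairing -RintegralZl//; last first.
    exact: (integrable_pairing p_gt1 hq hpq (hh j) xp).
  apply: eq_Rintegral => w _.
  by change (- h j w * x w = -1 * (h j w * x w)); ring.
have ghP x : x \in Lfun mu p -> (forall i, lp_pairing mu (gh i) x <= ab i) <->
    (forall i, lp_pairing mu (g i) x <= a i) /\ (forall j, lp_pairing mu (h j) x = b j).
  move=> xp; split=> [ghx|[gx hx] [i|[j|j]]] /=.
  - split=> [i|j]; first exact: (ghx (inl i)).
    apply/eqP; rewrite eq_le (ghx (inr (inl j)))/=.
    by have := ghx (inr (inr j)); rewrite /= pairingN// lerN2.
  - exact: gx.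
  - by rewrite hx.
  - by rewrite pairingN// hx.
have [||G [Gq GN0 Gcomp]] := no_interior_point_rigidity p_gt1 hq hpq mxa mxb
    xab ghq boxbar (b := ab).
- by apply/ghP => //; case: boxbar.
- move=> [x [xp xi] /(ghP _ xp)[gx hx]]; apply: no_slater.
  by exists x.
have [mG _] := (in_LfunP _ _ _).1 Gq.
have compbar := Gcomp _ boxbar ((ghP _ boxbar.1).2 (conj gbar hbar)).
pose D := [set w | G w != 0].
have mD : measurable D.
  rewrite (_ : D = ~` (G @^-1` [set 0])); last by apply/seteqP; split => w /eqP.
  by apply: measurableC; rewrite -[X in measurable X]setTI; exact: mG.
have D0 : mu D != 0%E.
  apply/eqP => D0; apply: GN0; exists D; split => // w /=.
  by move=> Gw; apply/eqP.
pose M w := \sum_(i < n) `|g i w| + \sum_(j < m) `|h j w|.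
have mM : measurable_fun [set: T] M.
  apply: measurable_funD; apply: measurable_sum => i; apply: measurableT_comp => //.
    by have [] := (in_LfunP _ _ _).1 (hg i).
  by have [] := (in_LfunP _ _ _).1 (hh i).
have [phi [phi0 phiq phiN]] := Lfun_not_dominated hq q_lty mu_nonatomic mD D0 mM.
have [mphi _] := (in_LfunP _ _ _).1 phiq.
pose F w := if 0 < G w then - phi w else if G w < 0 then phi w else 0.
have mF : measurable_fun [set: T] F.
  apply: measurable_fun_ifT; first exact: measurable_fun_ltr.
    exact: measurable_funN.
  by apply: measurable_fun_ifT => //; exact: measurable_fun_ltr.
have Fq : F \in Lfun mu q.
  apply: (ae_le_Lfun hq mF phiq); apply: nearW => w; rewrite /F.
  by case: ifP => _; [rewrite normrN|case: ifP => _ //; rewrite normr0].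
exists F => //; split.
  move=> x [xbox [xp gx hx]].
  have compx := Gcomp _ xbox ((ghP _ xp).2 (conj gx hx)).
  (* xbar and x agree wherever F is nonzero *)
  suff -> : lp_pairing mu F xbar = lp_pairing mu F x by [].
  congr fine; apply: ae_eq_integral => //.
  - exact: measurable_int (integrable_pairing p_gt1 hq hpq Fq boxbar.1).
  - exact: measurable_int (integrable_pairing p_gt1 hq hpq Fq xp).
  apply: filterS2 compbar compx => w [barpos barneg] [xpos xneg] _.
  congr EFin; rewrite /F; case: ifPn => [Gw|_].
    by move: (xpos Gw); rewrite (barpos Gw) => -[->].
  case: ifPn => [Gw|_]; last by rewrite !mul0r.
  by move: (xneg Gw); rewrite -(barneg Gw) => -[->].
move=> [zeta [alpha [beta [_ _ Fzeta [zeta_a _ zeta_b]]]]].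
pose C := \sum_(i < n) `|alpha i| + \sum_(j < m) `|beta j|.
have C0 : 0 <= C by rewrite addr_ge0// sumr_ge0.
apply: (phiN C C0).
apply: filterS3 (filterI Fzeta xab) compbar (filterI zeta_a zeta_b).
move=> w [Fw abw] [barpos barneg] [za zb] Dw.
(* in both sign cases zeta has the sign that gives phi w <= |A + B| *)
set A := \sum_(i < n | _) _ in Fw; set B := \sum_(j < m) _ in Fw.
have ABle : `|A + B| <= C * M w.
  apply: (le_trans (ler_normD _ _)); rewrite /C /M mulrDl !mulrDr.
  have hA := ler_norm_sum_mul (active mu g a xbar) alpha (g ^~ w).
  have hB := ler_norm_sum_mul xpredT beta (h ^~ w).
  apply: lerD; first by apply: (le_trans hA); rewrite lerDl mulr_ge0// sumr_ge0.
  by apply: (le_trans hB); rewrite lerDr mulr_ge0// sumr_ge0.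
apply: le_trans ABle; move: Fw; rewrite /F.
have [Gw|Gw|Gw] := ltgtP 0 (G w).
- have zw : zeta w <= 0 by apply: za; rewrite -?(barpos Gw).
  by move=> E; apply: le_trans (ler_norm _); lra.
- have zw : 0 <= zeta w by apply: zb; rewrite ?(barneg Gw).
  by move=> E; rewrite -normrN; apply: le_trans (ler_norm _); lra.
- by move: Dw; rewrite /D /= -Gw eqxx.
Qed.
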